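(* Let $G$ be a graph and let $k$ be a positive integer. Assume that $G$ is $(3k-3)$-edge-connected or $(2k-2)$-tree-connected. If there is a vertex set $Z\subseteq V(G)$ with $|E(G)|\equiv \sum_{v\in Z} d_G(v) \pmod k$, then $G$ can be edge-decomposed into $k$ factors $G_1,\ldots,G_k$ satisfying $\big||E(G_i)|-|E(G)|/k\big|<1$ for all $i$, such that for each $i$ and each vertex $v$, $$|d_{G_i}(v)-d_G(v)/k|<1.$$ Furthermore, the same conclusion holds if instead $G$ is a loopless $(2k-1)$-edge-connected essentially $(3k-3)$-edge-connected graph (with such a set $Z$).
   Context: Graphs are finite and may have loops and multiple edges; a loop contributes $2$ to the degree $d_G(v)$. A factor is a spanning subgraph; ''edge-decomposed into factors $G_1,\ldots,G_k$'' means $E(G)$ is partitioned into $E(G_1),\ldots,E(G_k)$ with each $G_i$ spanning. A graph is $m$-tree-connected if it contains $m$ edge-disjoint spanning trees. A graph is essentially $\lambda$-edge-connected if all edges of any edge cut of size strictly less than $\lambda$ are incident with a single vertex. *)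

(* Defs.v *)
From mathcomp Require Import all_boot all_order all_algebra.

Set Implicit Arguments.
Unset Strict Implicit.
Unset Printing Implicit Defensive.

(* The order of the two ends of an edge carries no meaning: every notion below
   is symmetric in them.  [ends e = (v, v)] is a loop. *)
Record multigraph := Multigraph {
  vertex : finType;
  edge : finType;
  ends : edge -> vertex * vertex
}.

(* A spanning subgraph (factor) of [G] is given by its edge set. *)

(* Degree of [v] in the factor with edge set [F]; a loop at [v] contributes 2. *)
Definition degree_in (G : multigraph) (F : {set edge G}) (v : vertex G) : nat :=
  \sum_(e in F) (((ends e).1 == v) + ((ends e).2 == v)).

Definition degree (G : multigraph) (v : vertex G) : nat :=
  degree_in [set: edge G] v.

Definition incident (G : multigraph) (e : edge G) (v : vertex G) : bool :=
  ((ends e).1 == v) || ((ends e).2 == v).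

Definition loopless (G : multigraph) : Prop :=
  forall e : edge G, (ends e).1 != (ends e).2.

Definition edge_cut (G : multigraph) (X : {set vertex G}) : {set edge G} :=
  [set e | ((ends e).1 \in X) (+) ((ends e).2 \in X)].

Definition edge_connected (lambda : nat) (G : multigraph) : Prop :=
  forall X : {set vertex G}, X != set0 -> X != [set: vertex G] ->
    lambda <= #|edge_cut X|.

Definition essentially_edge_connected (lambda : nat) (G : multigraph) : Prop :=
  forall X : {set vertex G}, X != set0 -> X != [set: vertex G] ->
    #|edge_cut X| < lambda ->
    exists v : vertex G, forall e, e \in edge_cut X -> incident e v.

Definition adjacent_in (G : multigraph) (F : {set edge G}) : rel (vertex G) :=
  fun x y => [exists e in F, (ends e == (x, y)) || (ends e == (y, x))].

Definition connected_factor (G : multigraph) (F : {set edge G}) : Prop :=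
  forall x y : vertex G, connect (adjacent_in F) x y.

(* A dart is an edge together with a direction of traversal. *)
Definition dart (G : multigraph) : Type := (edge G * bool)%type.

Definition dart_source (G : multigraph) (a : dart G) : vertex G :=
  if a.2 then (ends a.1).1 else (ends a.1).2.

Definition dart_target (G : multigraph) (a : dart G) : vertex G :=
  if a.2 then (ends a.1).2 else (ends a.1).1.

(* Cycles of length 1 (a loop) and 2 (two distinct parallel edges) are included;
   distinctness of the edges rules out going back and forth along one edge. *)
Definition graph_cycle (G : multigraph) (F : {set edge G}) (c : seq (dart G)) :
    Prop :=
  [/\ c <> [::],
      all (fun a => a.1 \in F) c,
      cycle (fun a b => dart_target a == dart_source b) c,
      uniq [seq dart_source a | a <- c]
    & uniq [seq a.1 | a <- c]].

Definition spanning_tree (G : multigraph) (F : {set edge G}) : Prop :=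
  connected_factor F /\ ~ (exists c : seq (dart G), graph_cycle F c).

Definition edge_disjoint (G : multigraph) (n : nat) (F : 'I_n -> {set edge G}) :
    Prop :=
  forall i j : 'I_n, i != j -> [disjoint F i & F j].

Definition tree_connected (m : nat) (G : multigraph) : Prop :=
  exists T : 'I_m -> {set edge G},
    (forall i, spanning_tree (T i)) /\ edge_disjoint T.

Definition edge_decomposition (G : multigraph) (k : nat)
    (F : 'I_k -> {set edge G}) : Prop :=
  edge_disjoint F /\ \bigcup_(i < k) F i = [set: edge G].

(* Main.v *)
Require Import Defs.
From mathcomp Require Import all_boot all_order all_algebra zify.

Import Order.TTheory GRing.Theory Num.Theory.
Local Open Scope ring_scope.

(* All three connectivity hypotheses force G to be (2k-2)-edge-connected, and
   that is enough.  Walk around a cycle of length k, taking d(v) steps forward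
   for v outside Z and backward for v in Z; by the congruence for Z the walk is
   closed and winds an even number of times.  If O(v, j) is the parity of the
   number of times the steps of v use the j-th edge of the cycle, then each O(., j)
   has even support, and O(v, .) has as many odd entries as an equitable
   splitting of d(v) into k parts.  A (2k-2)-edge-connected graph contains k-1
   disjoint connected factors (Nash-Williams and Tutte, proved by exchanges in a
   maximum packing of forests); taking a T-join in each and leaving the
   remaining edges to the last colour yields a k-colouring of the edges where
   colour j has degree parity O(v, j) at v.
   Next, recolour along trails alternating between two colours.  This keeps the
   number of odd colours at each vertex and makes all colour degrees at a vertex
   differ by at most 2; together with the parities this forces differences of at
   most 1.  Finally, swapping an alternating trail with both end edges in the
   larger of two colour classes balances the numbers of edges. *)
Set Implicit Arguments.
Unset Strict Implicit.
Unset Printing Implicit Defensive.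

Local Open Scope nat_scope.

(** * Alternating orbits of two involutions *)

Section Involutions.
Variables (D : finType) (a b : D -> D).
Hypotheses (aK : involutive a) (bK : involutive b).

Let g x := b (a x).

Definition alt_orbit x := [set y | fconnect (fun z => b (a z)) x y].

Lemma alt_step_inj : injective g.
Proof. exact: inj_comp (can_inj bK) (can_inj aK). Qed.

Lemma alt_orbit_refl x : x \in alt_orbit x.
Proof. by rewrite inE connect0. Qed.

Lemma alt_orbitP x y : reflect (exists n, y = iter n g x) (y \in alt_orbit x).
Proof.
rewrite inE; apply: (iffP idP) => [h|[n ->]]; last exact: fconnect_iter.
by exists (findex g x y); rewrite iter_findex.
Qed.

Lemma alt_orbit_stepE x y : (g y \in alt_orbit x) = (y \in alt_orbit x).
Proof. by rewrite !inE -same_fconnect1_r //; apply: alt_step_inj. Qed.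

Lemma alt_orbit_flip x y : b x = x -> y \in alt_orbit x -> a y \in alt_orbit x.
Proof.
move=> bx /alt_orbitP[n ->]; elim: n => [|n IHn] /=.
  by rewrite -alt_orbit_stepE /g aK bx alt_orbit_refl.
by rewrite -alt_orbit_stepE /g aK bK.
Qed.

Lemma alt_orbit_pair x y : b x = x -> y \in alt_orbit x -> b y \in alt_orbit x.
Proof.
by move=> bx /(alt_orbit_flip bx) h; rewrite -(aK y) alt_orbit_stepE.
Qed.

(* Read from [x], the orbit is a path traversed back and forth: [b] sends its
   [n]-th element to its [-n]-th one. *)
Lemma alt_orbit_fix x n :
  b x = x -> b (iter n g x) = iter n g x -> iter (n + n) g x = x.
Proof.
move=> bx.
have rev m : iter m g (b (iter m g x)) = x.
  elim: m => [//|m IHm]; rewrite iterSr /= {2}/g -[RHS]IHm; congr iter.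
  by rewrite /g bK aK.
by move=> bn; rewrite iterD -bn rev.
Qed.

Lemma alt_orbit_two_ends x y z : b x = x -> b y = y -> b z = z ->
  y \in alt_orbit x -> z \in alt_orbit x -> y != x -> z != x -> y = z.
Proof.
move=> bx by_ bz hy hz.
have key w : b w = w -> w \in alt_orbit x -> w != x ->
    findex g x w + findex g x w = order g x.
  rewrite inE => bw hw wx.
  have lt : findex g x w < order g x := findex_max hw.
  have e : iter (findex g x w) g x = w := iter_findex hw.
  have := @alt_orbit_fix x (findex g x w) bx; rewrite e => /(_ bw) e2.
  have n0 : findex g x w != 0 by apply: contra wx => /eqP n0; rewrite -e n0.
  case: (ltngtP (findex g x w + findex g x w) (order g x)) => // lt2.
    have := findex_iter lt2; rewrite e2 findex0 //; lia.
  have lt3 : findex g x w + findex g x w - order g x < order g x by lia.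
  have e4 : iter (findex g x w + findex g x w - order g x) g x = x.
    rewrite -[RHS]e2 -[in RHS](subnK (ltnW lt2)) iterD.
    by rewrite (iter_order alt_step_inj).
  have := findex_iter lt3; rewrite e4 findex0; lia.
move=> yx zx.
have ey := key y by_ hy yx; have ez := key z bz hz zx.
move: hy hz; rewrite !inE => /iter_findex <- /iter_findex <-.
by have -> : findex g x y = findex g x z by lia.
Qed.
End Involutions.


(* An involution matching the darts [A] at each vertex: darts of opposite
   colours first; what remains there has one colour, and is left unmatched where
   [q] holds and matched with itself, up to one dart, elsewhere. *)
Record pairing (D V : finType) (s : D -> V) (c : D -> bool) (q : pred V)
    (A : {set D}) (b : D -> D) : Prop := Pairing {
  pairingK : involutive b;
  pairing_src x : s (b x) = s x;
  pairing_out x : x \notin A -> b x = x;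
  pairing_mono x y : x \in A -> y \in A -> s x = s y ->
    c (b x) = c x -> c (b y) = c y -> c x = c y;
  pairing_fix x : x \in A -> q (s x) -> c (b x) = c x -> b x = x;
  pairing_fix1 x y : x \in A -> y \in A -> s x = s y -> ~~ q (s x) ->
    b x = x -> b y = y -> x = y
}.

Lemma pairing_swap (D V : finType) (s : D -> V) c (q : pred V) (A : {set D}) b x y :
  pairing s c q (A :\ x :\ y) b ->
  x \in A -> y \in A -> x != y -> s x = s y ->
  (c x != c y) ||
    (~~ q (s x) && [forall x in A, forall y in A, (s x == s y) ==> (c x == c y)]) ->
  pairing s c q A (fun z => if z == x then y else if z == y then x else b z).
Proof.
move=> [bK bs bout bmono bfix bfix1] xA yA xy sxy cxy.
have bx : b x = x by apply: bout; rewrite !inE eqxx andbF.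
have by_ : b y = y by apply: bout; rewrite !inE eqxx.
have bne z : z != x -> z != y -> (b z != x) * (b z != y).
  by move=> zx zy; split; [rewrite -bx | rewrite -by_]; rewrite (can_eq bK).
have yx : (y == x) = false by rewrite eq_sym; apply/negbTE.
have inA z : z \in A -> z != x -> z != y -> z \in A :\ x :\ y.
  by rewrite !inE => -> -> ->.
split=> [z|z|z|z w|z|z w].
- case: (eqVneq z x) => [->|zx]; first by rewrite yx eqxx.
  case: (eqVneq z y) => [->|zy]; first by rewrite eqxx.
  by rewrite !(negbTE (bne z zx zy).1) !(negbTE (bne z zx zy).2) bK.
- case: (eqVneq z x) => [->|zx]; first by rewrite sxy.
  by case: (eqVneq z y) => [->|zy]; rewrite ?sxy ?bs.
- case: (eqVneq z x) => [->|zx]; first by rewrite xA.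
  case: (eqVneq z y) => [->|zy]; first by rewrite yA.
  by move=> zA; apply: bout; rewrite !inE (negbTE zA) !andbF.
- move=> zA wA szw.
  case/orP: cxy => [cxy|/andP[_ /forall_inP/(_ z zA)/forall_inP/(_ w wA)]]; last first.
    by rewrite szw eqxx /= => /eqP.
  case: (eqVneq z x) => [->|zx]; first by move/eqP; rewrite eq_sym (negbTE cxy).
  case: (eqVneq z y) => [->|zy]; first by move/eqP; rewrite (negbTE cxy).
  case: (eqVneq w x) => [->|wx]; first by move=> _ /eqP; rewrite eq_sym (negbTE cxy).
  case: (eqVneq w y) => [->|wy]; first by move=> _ /eqP; rewrite (negbTE cxy).
  by apply: bmono => //; apply: inA.
- move=> zA.
  case: (eqVneq z x) => [->|zx] qz.
    by move/eqP; case/orP: cxy => [|/andP[]]; rewrite ?qz // eq_sym => /negbTE->.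
  case: (eqVneq z y) qz => [->|zy] qz.
    by move/eqP; case/orP: cxy => [/negbTE->|/andP[]] //; rewrite sxy qz.
  by apply: bfix => //; apply: inA.
- move=> zA wA szw nq.
  case: (eqVneq z x) => [->|zx]; first by move/eqP; rewrite yx.
  case: (eqVneq z y) => [->|zy]; first by move/eqP; rewrite (negbTE xy).
  case: (eqVneq w x) => [->|wx]; first by move=> _ /eqP; rewrite yx.
  case: (eqVneq w y) => [->|wy]; first by move=> _ /eqP; rewrite (negbTE xy).
  by apply: bfix1 => //; apply: inA.
Qed.

Lemma pairing_exists (D V : finType) (s : D -> V) (c : D -> bool) (q : pred V)
    (A : {set D}) : exists b, pairing s c q A b.
Proof.
have [n] := ubnP #|A|; elim: n A => // n IHn A lt.
pose P x y := (c x != c y) ||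
  (~~ q (s x) && [forall x in A, forall y in A, (s x == s y) ==> (c x == c y)]).
case: (boolP [exists x in A, exists y in A, [&& x != y, s x == s y & P x y]]).
  move=> /exists_inP[x xA /exists_inP[y yA /and3P[xy /eqP sxy cxy]]].
  have [|b bP] := IHn (A :\ x :\ y).
    have := cardsD1 x A; have := cardsD1 y (A :\ x); rewrite xA !inE yA; lia.
  by exists (fun z => if z == x then y else if z == y then x else b z); apply: pairing_swap.
move=> /exists_inPn noP; exists id; split=> // x y xA yA sxy.
  move=> _ _; apply/eqP; apply/negPn/negP => cxy.
  have /exists_inPn/(_ y yA) := noP x xA.
  rewrite /P sxy eqxx cxy /= andbT negbK => /eqP exy.
  by rewrite exy eqxx in cxy.
move=> nq _ _; apply/eqP/negPn/negP => xy.
have /exists_inPn/(_ y yA) := noP x xA.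
rewrite xy sxy eqxx /= /P nq /= negb_or => /andP[_ /negP[]].
apply/forall_inP => z zA; apply/forall_inP => w wA; apply/implyP => /eqP szw.
apply/negPn/negP => czw; have /exists_inPn/(_ w wA) := noP z zA.
rewrite /P czw szw eqxx andbT negbK => /eqP ezw.
by rewrite ezw eqxx in czw.
Qed.

(** * Swapping two colours *)

Lemma involution_odd_card (D : finType) (b : D -> D) (Y : {set D}) :
  involutive b -> {in Y, forall x, b x \in Y} ->
  odd #|Y| = odd #|[set x in Y | b x == x]|.
Proof.
move=> bK; have [n] := ubnP #|Y|; elim: n Y => // n IHn Y lt clY.
case: (boolP [exists x in Y, b x != x]) => [/exists_inP[x xY bx]|/exists_inPn fixY].
  have := IHn (Y :\ x :\ b x).
  have cY := cardsD1 x Y; have := cardsD1 (b x) (Y :\ x).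
  rewrite xY !inE bx clY //= in cY * => cYx.
  have -> : [set y in Y :\ x :\ b x | b y == y] = [set y in Y | b y == y].
    apply/setP => y; rewrite !inE.
    case: (eqVneq y (b x)) => [->|_] /=; first by rewrite bK eq_sym (negbTE bx) andbF.
    by case: (eqVneq y x) => [->|_] /=; rewrite ?(negbTE bx) ?andbF ?andbT.
  move=> <-; first by rewrite cY cYx /= negbK.
    by lia.
  move=> y; rewrite !inE => /and3P[ybx yx yY].
  by rewrite (can_eq bK) yx -{1}[x]bK (can_eq bK) ybx clY.
congr (odd #|pred_of_set _|); apply/setP => y; rewrite !inE.
by case: (boolP (y \in Y)) => //= /fixY/negPn->.
Qed.

Section Colouring.
Variables (G : multigraph) (k : nat).
Implicit Types (c : {ffun edge G -> 'I_k}) (u v : vertex G).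

Definition col_class c (i : 'I_k) : {set edge G} := [set e | c e == i].
Definition col_degree c i v := degree_in (col_class c i) v.

Lemma degree_in_darts (F : {set edge G}) v :
  degree_in F v = #|[set x : edge G * bool | (x.1 \in F) && (dart_source x == v)]|.
Proof.
rewrite /degree_in -sum1dep_card (eq_bigl (fun x : edge G * bool =>
  (x.1 \in F) && (dart_source x == v))) //.
rewrite -(pair_big_dep (fun e => e \in F) (fun e t => @dart_source G (e, t) == v)
  (fun _ _ => 1)) /=.
apply: eq_bigr => e _; rewrite big_mkcond big_bool /dart_source /=.
by do 2!case: (_ == v).
Qed.

Lemma sum_degree_in (F : {set edge G}) : \sum_v degree_in F v = (#|F|).*2.
Proof.
have one (a : vertex G) : \sum_v (a == v) = 1.
  rewrite (bigD1 a) //= eqxx big1 // => v.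
  by rewrite eq_sym => /negbTE->.
rewrite exchange_big /= -muln2 -sum_nat_const; apply: eq_bigr => e _.
by rewrite big_split /= !one.
Qed.

Lemma sum_col_degree c v : \sum_i col_degree c i v = degree v.
Proof.
rewrite /col_degree /degree /degree_in [RHS](partition_big c predT) //=.
apply: eq_bigr => i _; apply: eq_bigl => e.
by rewrite !inE.
Qed.

Lemma sum_col_class c : \sum_i #|col_class c i| = #|edge G|.
Proof.
rewrite -sum1_card [RHS](partition_big c predT) //=.
by apply: eq_bigr => i _; rewrite -sum1_card; apply: eq_bigl => e; rewrite !inE.
Qed.

Section Swap.
Variables (c : {ffun edge G -> 'I_k}) (i j : 'I_k) (q : pred (vertex G)).
Hypothesis ij : i != j.
Definition in_first (x : edge G * bool) := c x.1 == i.
Definition swap_darts : {set edge G * bool} := [set x | (c x.1 == i) || (c x.1 == j)].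
Definition flip (x : edge G * bool) : edge G * bool := (x.1, ~~ x.2).
Variable b : edge G * bool -> edge G * bool.
Hypothesis bP : pairing (@dart_source G) in_first q swap_darts b.
Let A := swap_darts.

Definition half_darts (t : bool) u (X : {set edge G * bool}) :=
  [set x in X | (dart_source x == u) && (in_first x == t)].
Definition unmatched (t : bool) u (X : {set edge G * bool}) :=
  [set x in X | [&& dart_source x == u, in_first x == t & in_first (b x) == t]].

Lemma unmatchedP t u (X : {set edge G * bool}) x :
  reflect [/\ x \in X, dart_source x = u, in_first x = t & in_first (b x) = t]
    (x \in unmatched t u X).
Proof.
rewrite in_set; apply: (iffP and4P) => [[? /eqP ? /eqP ? /eqP ?]|[-> -> -> ->]] //.
Qed.

Lemma flipK : involutive flip.
Proof. by case=> e t; rewrite /flip /= negbK. Qed.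

Lemma unmatched_balance u (X : {set edge G * bool}) : {in X, forall x, b x \in X} ->
  #|half_darts true u X| + #|unmatched false u X|
    = #|half_darts false u X| + #|unmatched true u X|.
Proof.
move=> clX.
pose bi t := [set x in X | [&& dart_source x == u, in_first x == t & in_first (b x) == ~~ t]].
have split_half t : #|half_darts t u X| = #|unmatched t u X| + #|bi t|.
  rewrite -(cardsID (unmatched t u X) (half_darts t u X)).
  congr (_ + _); apply: eq_card => x; rewrite !inE.
    by case: (x \in X) => //=; case: (_ == u) => //=; case: (in_first x == t).
  case: (x \in X) => //=; case: (_ == u) => //=; case: (in_first x == t) => //=.
  by rewrite andbT; case: (in_first (b x)); case: t.
suff e : #|bi true| = #|bi false| by rewrite !split_half e; lia.
rewrite -(card_imset _ (can_inj (pairingK bP))); apply: eq_card => x.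
apply/imsetP/idP => [[y]|].
  rewrite !inE => /and4P[yX sy cy cby] ->.
  by rewrite clX // (pairing_src bP) sy (pairingK bP) cy (eqP cby).
rewrite !inE => /and4P[xX sx cx cbx]; exists (b x); last by rewrite (pairingK bP).
by rewrite !inE clX // (pairing_src bP) sx (pairingK bP) cbx (eqP cx).
Qed.

Lemma swap_darts_pairing : {in A, forall x, b x \in A}.
Proof.
move=> x xA; apply/negPn/negP => bxA; have := pairing_out bP bxA.
by rewrite (pairingK bP) => e; rewrite -e xA in bxA.
Qed.

Lemma unmatched_one_sided u : (#|unmatched true u A| == 0) || (#|unmatched false u A| == 0).
Proof.
rewrite !cards_eq0; apply/norP => -[/set0Pn[x xu] /set0Pn[y yu]].
case/unmatchedP: xu => xA sx cx cbx; case/unmatchedP: yu => yA sy cy cby.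
have := pairing_mono bP xA yA; rewrite sx sy cx cy cbx cby.
by move=> /(_ erefl erefl erefl).
Qed.

Lemma unmatched_col_degree u :
  col_degree c i u + #|unmatched false u A| = col_degree c j u + #|unmatched true u A|.
Proof.
have := unmatched_balance u swap_darts_pairing.
suff: #|half_darts true u A| = col_degree c i u /\ #|half_darts false u A| = col_degree c j u.
  by case=> -> ->.
rewrite /col_degree !degree_in_darts; split; apply: eq_card => x; rewrite !inE /in_first.
  by case: (c x.1 == i); rewrite ?andbF ?andbT.
case: (eqVneq (c x.1) i) => [->|_]; first by rewrite (negbTE ij) andbF.
by rewrite andbT.
Qed.

Variable X : {set edge G * bool}.
Hypotheses (XA : X \subset A) (Xflip : {in X, forall x, flip x \in X})
  (Xb : {in X, forall x, b x \in X}).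

Definition swap_col : {ffun edge G -> 'I_k} :=
  [ffun e => if (e, true) \in X then (if c e == i then j else i) else c e].

Lemma swap_colE (x : edge G * bool) :
  swap_col x.1 = if x \in X then (if c x.1 == i then j else i) else c x.1.
Proof.
rewrite ffunE; suff -> : (x.1, true) \in X = (x \in X) by [].
case: x => e [] //=; apply/idP/idP => /Xflip; exact.
Qed.

Lemma swap_col_other l u : l != i -> l != j -> col_degree swap_col l u = col_degree c l u.
Proof.
move=> li lj; rewrite /col_degree !degree_in_darts; apply: eq_card => x.
rewrite !inE swap_colE; case: (boolP (x \in X)) => // /(subsetP XA).
rewrite inE; case: (eqVneq (c x.1) i) => [->|_] /=.
  by rewrite ![_ == l]eq_sym (negbTE li) (negbTE lj).
by move/eqP=> ->; rewrite ![_ == l]eq_sym (negbTE li) (negbTE lj).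
Qed.

Lemma swap_col_half u :
  col_degree swap_col i u + #|half_darts true u X| = col_degree c i u + #|half_darts false u X| /\
  col_degree swap_col j u + #|half_darts false u X| = col_degree c j u + #|half_darts true u X|.
Proof.
rewrite /col_degree !degree_in_darts.
pose N l := [set x : edge G * bool | (x.1 \in col_class c l) && (dart_source x == u)].
pose N' l := [set x : edge G * bool | (x.1 \in col_class swap_col l) && (dart_source x == u)].
rewrite -!/(N _) -!/(N' _).
have inN x : x \in X -> (c x.1 == j) = ~~ (c x.1 == i).
  move/(subsetP XA); rewrite inE; case: (eqVneq (c x.1) i) => [->|_] /=.
    by rewrite (negbTE ij).
  by move->.
have ji : j == i = false by rewrite eq_sym (negbTE ij).
have e1 : N i :&: X = half_darts true u X.
  apply/setP => x; rewrite !inE /in_first; case: (x \in X); rewrite ?andbF ?andbT //.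
  by rewrite eqb_id andbC.
have e2 : N j :&: X = half_darts false u X.
  apply/setP => x; rewrite !inE /in_first;
  case: (boolP (x \in X)) => [/inN->|]; rewrite ?andbF ?andbT //.
  by rewrite eqbF_neg andbC.
have e3 : N' i :&: X = half_darts false u X.
  apply/setP => x; rewrite !inE swap_colE /in_first; case: (x \in X); rewrite ?andbF ?andbT //.
  by case: (c x.1 == i); rewrite ?ji ?eqxx ?andbF ?andbT.
have e4 : N' j :&: X = half_darts true u X.
  apply/setP => x; rewrite !inE swap_colE /in_first; case: (x \in X); rewrite ?andbF ?andbT //.
  by case: (c x.1 == i); rewrite ?(negbTE ij) ?eqxx ?andbF ?andbT.
have e5 l : N' l :\: X = N l :\: X.
  by apply/setP => x; rewrite !inE swap_colE; case: (x \in X).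
have := cardsID X (N i); have := cardsID X (N j).
have := cardsID X (N' i); have := cardsID X (N' j).
rewrite !e5 e1 e2 e3 e4 => <- <- <- <-; by split; rewrite addnAC [X in X + _]addnC addnAC.
Qed.

Lemma swap_col_degree u :
  col_degree swap_col i u + #|unmatched true u X| = col_degree c i u + #|unmatched false u X| /\
  col_degree swap_col j u + #|unmatched false u X| = col_degree c j u + #|unmatched true u X|.
Proof.
have := unmatched_balance u Xb; have := swap_col_half u; lia.
Qed.

Lemma unmatched_sub t u : #|unmatched t u X| <= #|unmatched t u A|.
Proof.
apply/subset_leq_card/subsetP => x /unmatchedP[xX sx cx cbx].
by apply/unmatchedP; split=> //; apply: (subsetP XA).
Qed.

Lemma unmatched_even t u : ~~ q u -> ~~ odd #|unmatched t u A| -> ~~ odd #|unmatched t u X|.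
Proof.
have cl (Y : {set edge G * bool}) : {in Y, forall x, b x \in Y} ->
    {in unmatched t u Y, forall x, b x \in unmatched t u Y}.
  move=> clY x /unmatchedP[xY sx cx cbx]; apply/unmatchedP.
  by rewrite clY // (pairing_src bP) sx cbx (pairingK bP) cx.
move=> qu; rewrite (involution_odd_card (pairingK bP) (cl _ swap_darts_pairing)).
rewrite (involution_odd_card (pairingK bP) (cl _ Xb)).
set fA := [set x in _ | _]; set fX := [set x in _ | _] => oA.
suff /eqP-> : fX == set0 by rewrite cards0.
have fA1 : #|fA| <= 1.
  apply/card_le1_eqP => x y; rewrite [x \in _]in_set [y \in _]in_set.
  move=> /andP[/unmatchedP[xA sx _ _] /eqP bx] /andP[/unmatchedP[yA sy _ _] /eqP by_].
  apply: (pairing_fix1 bP yA xA) => //; first by rewrite sy sx.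
  by move: qu; rewrite -sy.
have /eqP : #|fA| = 0 by lia.
rewrite cards_eq0 => /eqP fA0; rewrite -subset0 -fA0; apply/subsetP => x.
rewrite [x \in fX]in_set => /andP[/unmatchedP[xX sx cx cbx] bx].
rewrite [x \in fA]in_set bx andbT; apply/unmatchedP.
by split=> //; apply: (subsetP XA).
Qed.
End Swap.
End Colouring.


Section Rebalancing.
Variables (G : multigraph) (k : nat).
Implicit Types (c : {ffun edge G -> 'I_k}) (u v : vertex G).

Lemma eq_sum_but2 (i j : 'I_k) (f g : 'I_k -> nat) : i != j ->
  (forall l, l != i -> l != j -> f l = g l) ->
  \sum_l f l + (g i + g j) = \sum_l g l + (f i + f j).
Proof.
move=> ij fg; have ji : j != i by rewrite eq_sym.
rewrite (bigD1 i) // (bigD1 j) //= [in RHS](bigD1 i) // [in RHS](bigD1 j) //=.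
rewrite (eq_bigr g); last by move=> l /andP[]; apply: fg.
lia.
Qed.

Section Orbits.
Variables (c : {ffun edge G -> 'I_k}) (i j : 'I_k) (q : pred (vertex G)).
Variable b : edge G * bool -> edge G * bool.
Hypothesis bP : pairing (@dart_source G) (in_first c i) q (swap_darts c i j) b.
Let A := swap_darts c i j.
Let orb x := alt_orbit (@flip G) b x.

Lemma alt_orbit_sub x : x \in A -> orb x \subset A.
Proof.
move=> xA; apply/subsetP => y /alt_orbitP[n ->]; elim: n => //= n IHn.
by apply: (swap_darts_pairing bP); move: IHn; rewrite !inE.
Qed.

Lemma unmatched_fix t u x : q u -> x \in unmatched c i b t u A -> b x = x.
Proof.
move=> qu /unmatchedP[xA sx cx cbx].
by apply: (pairing_fix bP xA); rewrite ?cbx ?cx // (_ : dart_source x = u).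
Qed.

Lemma unmatched_orbit_sub t u x : x \in A ->
  {subset unmatched c i b t u (orb x) <= unmatched c i b t u A}.
Proof.
move=> xA y /unmatchedP[yX sy cy cby]; apply/unmatchedP.
by split=> //; apply: (subsetP (alt_orbit_sub xA)).
Qed.

Lemma unmatched_in_orbit t u x : x \in unmatched c i b t u A -> x \in unmatched c i b t u (orb x).
Proof.
by case/unmatchedP=> xA sx cx cbx; apply/unmatchedP; split=> //; apply: alt_orbit_refl.
Qed.

Lemma card_unmatched_orbit t u x : q u -> x \in unmatched c i b t u A ->
  #|unmatched c i b t u (orb x)| <= 2.
Proof.
move=> qu xu; have bx := unmatched_fix qu xu.
have xA : x \in A by case/unmatchedP: xu.
rewrite (cardsD1 x) (unmatched_in_orbit xu) ltnS.
apply/card_le1_eqP => y z; rewrite !in_setD1.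
move=> /andP[yx yu] /andP[zx zu].
apply: (alt_orbit_two_ends (@flipK G) (pairingK bP) bx _ _ _ _ zx yx).
- exact: unmatched_fix qu (unmatched_orbit_sub xA zu).
- exact: unmatched_fix qu (unmatched_orbit_sub xA yu).
- by case/unmatchedP: zu.
- by case/unmatchedP: yu.
Qed.

Definition swappable (X : {set edge G * bool}) :=
  [/\ X \subset A, {in X, forall x, flip x \in X} & {in X, forall x, b x \in X}].

Lemma orbit_swappable x : x \in A -> b x = x -> swappable (orb x).
Proof.
move=> xA bx; split; first exact: alt_orbit_sub.
  by move=> y; apply: (alt_orbit_flip (@flipK G) (pairingK bP)).
by move=> y; apply: (alt_orbit_pair (@flipK G) (pairingK bP)).
Qed.

Lemma swappableU X Y : swappable X -> swappable Y -> swappable (X :|: Y).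
Proof.
move=> [XA Xf Xb] [YA Yf Yb]; split; first by rewrite subUset XA.
  by move=> x; rewrite !in_setU => /orP[/Xf->|/Yf->] //; rewrite orbT.
by move=> x; rewrite !in_setU => /orP[/Xb->|/Yb->] //; rewrite orbT.
Qed.

Lemma unmatched_swappable t u : q u -> 3 <= #|unmatched c i b t u A| ->
  exists X, [/\ swappable X, 0 < #|unmatched c i b t u X|,
    #|unmatched c i b t u X| < #|unmatched c i b t u A| &
    odd #|unmatched c i b t u A| || ~~ odd #|unmatched c i b t u X|].
Proof.
set d := #|_| => qu d3.
have good x : x \in unmatched c i b t u A -> swappable (orb x) /\
    0 < #|unmatched c i b t u (orb x)| <= 2.
  move=> xu; split; last first.
    rewrite card_unmatched_orbit // andbT; apply/card_gt0P; exists x.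
    exact: unmatched_in_orbit.
  by apply: orbit_swappable; [case/unmatchedP: xu | apply: unmatched_fix xu].
have /card_gt0P[x xu] : 0 < d by lia.
have [Xx /andP[mx1 mx2]] := good x xu.
case: (boolP (odd d || ~~ odd #|unmatched c i b t u (orb x)|)) => [okx|].
  by exists (orb x); split=> //; lia.
rewrite negb_or negbK => /andP[ed ox].
have [y yu yx] : exists2 y, y \in unmatched c i b t u A & y != x.
  have : 0 < #|unmatched c i b t u A :\ x|.
    by move: (cardsD1 x (unmatched c i b t u A)) d3; rewrite xu -/d; lia.
  by case/card_gt0P=> y; rewrite in_setD1 => /andP[? ?]; exists y.
have [Xy /andP[my1 my2]] := good y yu.
case: (boolP (odd #|unmatched c i b t u (orb y)|)) => oy; last first.
  by exists (orb y); split=> //; [lia | rewrite oy orbT].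
have only z : z \in unmatched c i b t u A -> odd #|unmatched c i b t u (orb z)| ->
    unmatched c i b t u (orb z) = [set z].
  move=> zu oz; have [_ /andP[mz1 mz2]] := good z zu.
  have /cards1P[w ew] : #|unmatched c i b t u (orb z)| == 1 by lia.
  by have := unmatched_in_orbit zu; rewrite ew inE => /eqP->.
have e2 : unmatched c i b t u (orb x :|: orb y) = [set x; y].
  rewrite -(only x xu ox) -(only y yu oy); apply/setP => z.
  by rewrite !in_set -andb_orl.
exists (orb x :|: orb y); rewrite e2 cards2 eq_sym yx; split=> //.
  exact: swappableU.
by rewrite orbT.
Qed.
End Orbits.

Definition odd_colours c u := \sum_(l < k) odd (col_degree c l u).
Definition energy c u := \sum_(l < k) col_degree c l u ^ 2.

Lemma rebalance c i j v : col_degree c j v + 3 <= col_degree c i v ->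
  exists c', [/\ forall u, odd_colours c' u = odd_colours c u,
    forall u, energy c' u <= energy c u & energy c' v < energy c v].
Proof.
move=> ge3; have ij : i != j by apply: contraTneq ge3 => ->; lia.
have [b bP] := pairing_exists (@dart_source G) (in_first c i) (pred1 v) (swap_darts c i j).
have degA := unmatched_col_degree ij bP; have oneA := unmatched_one_sided bP.
have d3 : 3 <= #|unmatched c i b true v (swap_darts c i j)|.
  have := degA v; have := oneA v; lia.
have [X [[XA Xf Xb] m0 md odd_m]] := unmatched_swappable bP (eqxx v) d3.
exists (swap_col c i j X).
have degX := swap_col_degree ij bP XA Xf Xb.
have other u l : l != i -> l != j -> col_degree (swap_col c i j X) l u = col_degree c l u.
  exact: swap_col_other XA Xf l u.
have energyE u : energy (swap_col c i j X) u + (col_degree c i u ^ 2 + col_degree c j u ^ 2)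
    = energy c u + (col_degree (swap_col c i j X) i u ^ 2 + col_degree (swap_col c i j X) j u ^ 2).
  by apply: (eq_sum_but2 ij) => l li lj; rewrite other.
have oddE u : odd_colours (swap_col c i j X) u + (odd (col_degree c i u) + odd (col_degree c j u))
    = odd_colours c u + (odd (col_degree (swap_col c i j X) i u)
        + odd (col_degree (swap_col c i j X) j u)).
  by apply: (eq_sum_but2 ij) => l li lj; rewrite other.
have subX t u := unmatched_sub b XA t u.
have evenX t u : u != v -> ~~ odd #|unmatched c i b t u (swap_darts c i j)| ->
    ~~ odd #|unmatched c i b t u X|.
  by move=> uv; apply: (unmatched_even ij bP XA Xb).
split=> [u|u|].
- have := oddE u; have [e1 e2] := degX u; have e3 := degA u; have := oneA u.
  have s1 := subX true u; have s2 := subX false u.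
  case: (eqVneq u v) => [eu|uv]; first by subst u; lia.
  have := evenX true u uv; have := evenX false u uv; lia.
- have := energyE u; have [e1 e2] := degX u; have e3 := degA u; have := oneA u.
  have s1 := subX true u; have s2 := subX false u; nia.
- have := energyE v; have [e1 e2] := degX v; have e3 := degA v; have := oneA v.
  have s1 := subX true v; have s2 := subX false v; nia.
Qed.
End Rebalancing.


Lemma near_equal_parity_equitable (k : nat) (y : 'I_k -> nat) :
  (forall i j, y i <= y j + 2) ->
  \sum_l odd (y l) = (if odd ((\sum_l y l) %/ k) then k - (\sum_l y l) %% k
                      else (\sum_l y l) %% k) ->
  forall i j, y i <= y j + 1.
Proof.
set d := \sum_l y l => y2 oddE i0 j0.
have k0 : 0 < k by case: k i0 {y d y2 oddE j0} => // -[].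
pose m l := d %/ k + (odd (y l) (+) odd (d %/ k)).
have summ : \sum_l m l = d.
  rewrite big_split /= sum_nat_const card_ord {3}(divn_eq d k) mulnC; congr (_ + _).
  move: oddE; have := ltn_pmod d k0; case: (odd _) => lt oddE; last first.
    by rewrite -oddE; apply: eq_bigr => l _; rewrite addbF.
  suff H : \sum_(l < k) (odd (y l) (+) true) + \sum_(l < k) odd (y l) = k.
    by move: H; rewrite oddE; move: (\sum_(i < k) _) => S; lia.
  rewrite -big_split /= -[RHS]card_ord -sum1_card; apply: eq_bigr => l _.
  by case: (odd _).
have all_or : (forall l, m l <= y l) \/ (forall l, y l <= m l).
  case: (boolP [forall l, m l <= y l]) => [/forallP|/forallPn[l0 hl0]]; first by left.
  right=> l; have := y2 l l0; rewrite /m in hl0 *; lia.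
have eq_m l : y l = m l.
  apply/eqP; case: all_or => le.
    have := leqif_sum (fun (l : 'I_k) (_ : true) => leqif_eq (le l)).
    by case=> _; rewrite summ eqxx => /esym/forall_inP/(_ l isT); rewrite eq_sym.
  have := leqif_sum (fun (l : 'I_k) (_ : true) => leqif_eq (le l)).
  by case=> _; rewrite summ eqxx => /esym/forall_inP/(_ l isT).
by rewrite (eq_m i0) (eq_m j0) /m; lia.
Qed.

Section Equitable.
Variables (G : multigraph) (k : nat).
Implicit Types (c : {ffun edge G -> 'I_k}) (u v : vertex G).

Lemma near_equal_colouring c :
  exists c', (forall u, odd_colours c' u = odd_colours c u) /\
    forall u i j, col_degree c' i u <= col_degree c' j u + 2.
Proof.
have [n] := ubnP (\sum_u energy c u); elim: n c => // n IHn c lt.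
case: (boolP [exists v, exists i, exists j, col_degree c j v + 3 <= col_degree c i v]).
  move=> /existsP[v /existsP[i /existsP[j ge3]]].
  have [c1 [odd1 le1 lt1]] := rebalance ge3.
  have [|c' [odd' near]] := IHn c1.
    apply: (leq_trans _ (ltnSE lt)); rewrite (bigD1 v) // [leqRHS](bigD1 v) //=.
    by rewrite -addSn leq_add // leq_sum.
  by exists c'; split=> // u; rewrite odd'.
move=> /existsPn noge3; exists c; split=> // u i j.
by have := noge3 u => /existsPn/(_ i)/existsPn/(_ j); lia.
Qed.

Definition equitable c := forall u i j, col_degree c i u <= col_degree c j u + 1.

Section Ends.
Variables (c : {ffun edge G -> 'I_k}) (i j : 'I_k) (b : edge G * bool -> edge G * bool).
Hypothesis bP : pairing (@dart_source G) (in_first c i) predT (swap_darts c i j) b.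
Hypothesis ij : i != j.
Let A := swap_darts c i j.

Definition ends_of (t : bool) (X : {set edge G * bool}) :=
  [set x in X | (in_first c i x == t) && (in_first c i (b x) == t)].

Lemma sum_unmatched t X : \sum_u #|unmatched c i b t u X| = #|ends_of t X|.
Proof.
rewrite -[RHS]sum1_card (partition_big (@dart_source G) predT) //=.
apply: eq_bigr => u _; rewrite -sum1_card; apply: eq_bigl => x.
by rewrite !inE; case: (x \in X); case: (_ == u); rewrite ?andbT ?andbF.
Qed.

Lemma ends_of_unmatched t X x : x \in ends_of t X -> x \in unmatched c i b t (dart_source x) X.
Proof. by rewrite !inE eqxx. Qed.

Lemma unmatched_ends_of t u X x : x \in unmatched c i b t u X -> x \in ends_of t X.
Proof. by rewrite !inE => /and4P[-> _ -> ->]. Qed.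

Lemma swap_class_card X : swappable c i j b X ->
  (#|col_class (swap_col c i j X) i|.*2 + #|ends_of true X| =
     #|col_class c i|.*2 + #|ends_of false X|) /\
  (#|col_class (swap_col c i j X) j|.*2 + #|ends_of false X| =
     #|col_class c j|.*2 + #|ends_of true X|).
Proof.
case=> XA Xf Xb; rewrite -!sum_degree_in -!sum_unmatched -!big_split /=.
by split; apply: eq_bigr => u _; case: (swap_col_degree ij bP XA Xf Xb u).
Qed.

Lemma class_card :
  #|col_class c i|.*2 + #|ends_of false A| = #|col_class c j|.*2 + #|ends_of true A|.
Proof.
rewrite -!sum_degree_in -!sum_unmatched -!big_split /=; apply: eq_bigr => u _.
exact: (unmatched_col_degree ij bP).
Qed.

Lemma end_fix t x : x \in ends_of t A -> b x = x.
Proof. by move/ends_of_unmatched; apply: (unmatched_fix bP). Qed.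

Let orb x := alt_orbit (@flip G) b x.

Lemma ends_of_orbit t x : x \in A -> {subset ends_of t (orb x) <= ends_of t A}.
Proof. by move=> xA y /ends_of_unmatched/(unmatched_orbit_sub bP xA)/unmatched_ends_of. Qed.

Lemma orbit_three_ends x y z : b x = x -> b y = y -> b z = z ->
  y \in orb x -> z \in orb x -> y != x -> z != x -> y = z.
Proof. exact: (alt_orbit_two_ends (@flipK G) (pairingK bP)). Qed.

Lemma first_end_exists : #|col_class c j| < #|col_class c i| ->
  exists2 x, x \in ends_of true A & ends_of false (orb x) = set0.
Proof.
move=> lt.
suff /exists_inP[x xE /eqP noend] : [exists x in ends_of true A, ends_of false (orb x) == set0].
  by exists x.
apply: contraT => /exists_inPn noend.
have cardA : #|ends_of false A| < #|ends_of true A| by have := class_card; lia.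
pose p x := odflt x [pick y in ends_of false (orb x)].
have pP x : x \in ends_of true A -> p x \in ends_of false (orb x).
  move=> /noend; rewrite /p; case: pickP => [y //|no] /eqP[].
  by apply/setP => y; rewrite no inE.
have endA x : x \in ends_of true A -> x \in A by rewrite inE => /andP[].
have p_inj : {in ends_of true A &, injective p}.
  move=> x x' xE x'E exx; apply/eqP/negPn/negP => neq.
  have [px px'] := (pP x xE, pP x' x'E).
  have pxA := ends_of_orbit (endA _ xE) px.
  have orb_sym y z : z \in orb y -> y \in orb z.
    by rewrite !inE fconnect_sym //; apply: alt_step_inj; [apply: flipK | apply: pairingK bP].
  have pxo : p x \in orb x by move: px; rewrite inE => /andP[].
  have px'o : p x \in orb x' by rewrite exx; move: px'; rewrite inE => /andP[].
  have x'o : x' \in orb x.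
    move: pxo (orb_sym _ _ px'o); rewrite !inE; exact: connect_trans.
  have ne1 : p x != x.
    by apply/eqP => e; move: px xE; rewrite e !inE => /andP[_ /andP[/eqP-> _]] /andP[_ /andP[]].
  have ne2 : x' != x by rewrite eq_sym.
  have := orbit_three_ends (end_fix xE) (end_fix pxA) (end_fix x'E) pxo x'o ne1 ne2.
  by move=> e; move: px x'E; rewrite e !inE => /andP[_ /andP[/eqP-> _]] /andP[_ /andP[]].
have : #|ends_of true A| <= #|ends_of false A|.
  rewrite -(card_in_imset p_inj); apply/subset_leq_card/subsetP => _ /imsetP[x xE ->].
  exact: (ends_of_orbit (endA _ xE) (pP x xE)).
lia.
Qed.

Lemma card_ends_orbit x : x \in ends_of true A -> ends_of false (orb x) = set0 ->
  #|ends_of true (orb x)| = 2.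
Proof.
move=> xE noend; have xA : x \in A by move: xE; rewrite inE => /andP[].
have bx := end_fix xE.
have xo : x \in ends_of true (orb x).
  by move: xE; rewrite !inE => /andP[_ ->]; rewrite connect0.
have := swap_class_card (orbit_swappable bP xA bx); rewrite noend cards0 => -[e _].
have : #|ends_of true (orb x)| <= 2.
  rewrite (cardsD1 x) xo ltnS; apply/card_le1_eqP => y z; rewrite !in_setD1.
  move=> /andP[yx yo] /andP[zx zo].
  apply: (orbit_three_ends bx _ _ _ _ zx yx).
  - exact: end_fix (ends_of_orbit xA zo).
  - exact: end_fix (ends_of_orbit xA yo).
  - by move: zo; rewrite inE => /andP[].
  - by move: yo; rewrite inE => /andP[].
have : 0 < #|ends_of true (orb x)| by apply/card_gt0P; exists x.
move: e; rewrite -[alt_orbit _ _ _]/(orb x); move: #|ends_of true _| => n; lia.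
Qed.
End Ends.

Lemma rebalance_size c i j : equitable c -> #|col_class c j| + 2 <= #|col_class c i| ->
  exists2 c', equitable c' &
    \sum_l #|col_class c' l| ^ 2 < \sum_l #|col_class c l| ^ 2.
Proof.
move=> eqc ge2; have ij : i != j by apply: contraTneq ge2 => ->; lia.
have [b bP] := pairing_exists (@dart_source G) (in_first c i) predT (swap_darts c i j).
have [|x xE noend] := first_end_exists bP ij; first by lia.
have e2 := card_ends_orbit bP ij xE noend.
have xA : x \in swap_darts c i j by move: xE; rewrite inE => /andP[].
have sw := orbit_swappable bP xA (end_fix bP xE).
set X := alt_orbit _ _ _ in noend e2 sw.
have [XA Xf Xb] := sw.
exists (swap_col c i j X).
  move=> u.
  suff key l : exists l', col_degree (swap_col c i j X) l u = col_degree c l' u.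
    by move=> l l'; have [l1 ->] := key l; have [l2 ->] := key l'; apply: eqc.
  have [eq1 eq2] := swap_col_degree ij bP XA Xf Xb u.
  have eq3 := unmatched_col_degree ij bP u; have one := unmatched_one_sided bP u.
  have s1 := unmatched_sub b XA true u; have s2 := unmatched_sub b XA false u.
  have ei := eqc u i j; have ej := eqc u j i.
  have cases : (col_degree (swap_col c i j X) i u = col_degree c i u /\
      col_degree (swap_col c i j X) j u = col_degree c j u) \/
    (col_degree (swap_col c i j X) i u = col_degree c j u /\
      col_degree (swap_col c i j X) j u = col_degree c i u) by lia.
  case: (eqVneq l i) => [->|li].
    by case: cases => -[e1 _]; [exists i | exists j].
  case: (eqVneq l j) => [->|lj].
    by case: cases => -[_ e1]; [exists j | exists i].
  by exists l; apply: (swap_col_other XA Xf).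
have [s1 s2] := swap_class_card bP ij sw; rewrite noend e2 cards0 in s1 s2.
have other l : l != i -> l != j ->
    #|col_class (swap_col c i j X) l| ^ 2 = #|col_class c l| ^ 2.
  move=> li lj; congr (_ ^ 2); apply: double_inj; rewrite -!sum_degree_in.
  by apply: eq_bigr => u _; apply: (swap_col_other XA Xf).
have := eq_sum_but2 ij other.
have ea : #|col_class c i| = #|col_class (swap_col c i j X) i| + 1 by lia.
have eb : #|col_class (swap_col c i j X) j| = #|col_class c j| + 1 by lia.
move: ge2; rewrite ea eb; move: #|col_class (swap_col _ _ _ _) i| #|col_class c j| => a0 b0.
move: (\sum_l _) (\sum_l _) => S S'; nia.
Qed.

Lemma equitable_sizes c : equitable c -> exists2 c', equitable c' &
  forall i j, #|col_class c' i| <= #|col_class c' j| + 1.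
Proof.
have [n] := ubnP (\sum_l #|col_class c l| ^ 2); elim: n c => // n IHn c lt eqc.
case: (boolP [exists i, exists j, #|col_class c j| + 2 <= #|col_class c i|]).
  move=> /existsP[i /existsP[j ge2]]; have [c1 eq1 lt1] := rebalance_size eqc ge2.
  by apply: IHn eq1; apply: leq_trans lt1 (ltnSE lt).
move=> /existsPn noge2; exists c => // i j.
by have /existsPn/(_ j) := noge2 i; lia.
Qed.
End Equitable.

(** * Packing connected factors *)

Section Packing.
Variable G : multigraph.
Implicit Types (F R : {set edge G}) (x y : vertex G) (e : edge G).

Definition linked F x y := connect (adjacent_in F) x y.
Definition joined F e := linked F (ends e).1 (ends e).2.

Lemma adjacentP F x y :
  reflect (exists2 e, e \in F & ends e = (x, y) \/ ends e = (y, x)) (adjacent_in F x y).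
Proof.
apply: (iffP exists_inP) => -[e eF].
  by case/orP=> /eqP; exists e => //; [left | right].
by case=> E; exists e; rewrite ?E ?eqxx ?orbT.
Qed.

Lemma linked_refl F x : linked F x x.
Proof. exact: connect0. Qed.

Lemma linked_trans F y x z : linked F x y -> linked F y z -> linked F x z.
Proof. exact: connect_trans. Qed.

Lemma linked_sym F x y : linked F x y = linked F y x.
Proof.
apply: sym_connect_sym => {}x {}y; apply/adjacentP/adjacentP => -[e eF h].
  by exists e => //; case: h; [right | left].
by exists e => //; case: h; [right | left].
Qed.

Lemma joined_mem F e : e \in F -> joined F e.
Proof. by move=> eF; apply/connect1/adjacentP; exists e => //; left; case: (ends e). Qed.

Lemma linked_close F R x y : (forall e, e \in F -> joined R e) -> linked F x y -> linked R x y.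
Proof.
move=> FR; apply: connect_sub => {}x {}y /adjacentP[e /FR]; rewrite /joined.
by move=> h [] E; move: h; rewrite E //= linked_sym.
Qed.

Lemma linkedS F R x y : F \subset R -> linked F x y -> linked R x y.
Proof. by move=> FR; apply: linked_close => e /(subsetP FR)/joined_mem. Qed.

Lemma linked_setU1 F e x y : linked (e |: F) x y ->
  [\/ linked F x y, linked F x (ends e).1 /\ linked F (ends e).2 y
    | linked F x (ends e).2 /\ linked F (ends e).1 y].
Proof.
case/connectP=> p; elim: p x => [|z p IHp] x /=.
  by move=> _ ->; constructor 1; apply: linked_refl.
case/andP=> /adjacentP[f]; rewrite !inE => fF xz /IHp{}IHp /IHp{IHp}.
case/orP: fF => [/eqP ef|fF].
  subst f; case: xz => -> /= [h|[h1 h2]|[h1 h2]].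
  - by constructor 2; split; first apply: linked_refl.
  - by constructor 2; split; first apply: linked_refl.
  - by constructor 1.
  - by constructor 3; split; first apply: linked_refl.
  - by constructor 1.
  - by constructor 3; split; first apply: linked_refl.
have xz' : linked F x z.
  by have := joined_mem fF; rewrite /joined; case: xz => -> //=; rewrite linked_sym.
case=> [h|[h1 h2]|[h1 h2]].
- by constructor 1; apply: linked_trans h.
- by constructor 2; split=> //; apply: linked_trans h1.
- by constructor 3; split=> //; apply: linked_trans h1.
Qed.

Definition forest F := [forall e in F, ~~ joined (F :\ e) e].

Lemma forestP F : reflect (forall e, e \in F -> ~~ joined (F :\ e) e) (forest F).
Proof. exact: forall_inP. Qed.

Lemma forestS F R : F \subset R -> forest R -> forest F.
Proof.
move=> FR /forestP fR; apply/forestP => e eF; apply: contra (fR e (subsetP FR e eF)).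
by apply: linkedS; apply: setSD.
Qed.

Lemma forest_setU1 F e : forest F -> ~~ joined F e -> forest (e |: F).
Proof.
move=> /forestP fF neF; apply/forestP => f; rewrite !inE.
case: (eqVneq f e) => [-> _|fe /= fF'].
  by apply: contra neF; apply: linkedS; apply/subsetP => g; rewrite !inE => /andP[/negbTE->].
apply/negP => h; have ff := fF f fF'.
have {}h : linked (e |: (F :\ f)) (ends f).1 (ends f).2.
  apply: linkedS h; apply/subsetP => g; rewrite !inE.
  by case: (g == e); case: (g == f); rewrite ?orbT.
have sub x y : linked (F :\ f) x y -> linked F x y by apply: linkedS; apply: subD1set.
have jf := joined_mem fF'; rewrite /joined in jf.
case: (linked_setU1 h) => [h1|[h1 h2]|[h1 h2]]; first by rewrite /joined h1 in ff.
  move/negP: neF; apply; rewrite /joined.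
  apply: (linked_trans (y := (ends f).1)); first by rewrite linked_sym; apply: sub.
  by apply: linked_trans jf _; rewrite linked_sym; apply: sub.
move/negP: neF; apply; rewrite /joined.
apply: (linked_trans (y := (ends f).2)); first exact: sub.
by rewrite linked_sym in jf; apply: linked_trans jf _; apply: sub.
Qed.

Definition bridges F x y := [set f in F | ~~ linked (F :\ f) x y].

(* A minimal subset of [F] linking [x] and [y] is the path between them, and in
   a forest each of its edges separates them. *)
Lemma linked_bridges F x y : forest F -> linked F x y -> linked (bridges F x y) x y.
Proof.
move=> /forestP fF xy.
have [M /minsetP[xyM minM] MF] := minset_exists (P := fun M => linked M x y) xy.
apply: (linkedS _ xyM); apply/subsetP => f fM; rewrite inE (subsetP MF) //=.
have nM : ~~ linked (M :\ f) x y.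
  apply/negP => h; have := minM _ h (subD1set M f) => e.
  by move: fM; rewrite -e !inE eqxx.
have sub u v : linked (M :\ f) u v -> linked (F :\ f) u v by apply: linkedS; apply: setSD.
apply/negP => h; have /negP[] := fF f (subsetP MF f fM); rewrite /joined.
have : linked (f |: (M :\ f)) x y by rewrite setD1K; [exact: xyM | exact: fM].
case/linked_setU1 => [h1|[h1 h2]|[h1 h2]]; first by rewrite h1 in nM.
  apply: (linked_trans (y := x)); first by rewrite linked_sym; apply: sub.
  by apply: linked_trans h _; rewrite linked_sym; apply: sub.
apply: (linked_trans (y := y)); first exact: sub.
by rewrite linked_sym in h; apply: linked_trans h _; apply: sub.
Qed.

Definition block F x := [set y | linked F x y].
Definition blocks F := [set block F x | x : vertex G].

Lemma block_eq F x y : (block F x == block F y) = linked F x y.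
Proof.
apply/eqP/idP => [/setP/(_ y)|xy]; first by rewrite !inE linked_refl.
apply/setP => z; rewrite !inE; apply/idP/idP => h; last exact: linked_trans h.
by apply: linked_trans h; rewrite linked_sym.
Qed.

Lemma card_blocks_setU1 F e : ~~ joined F e -> #|blocks (e |: F)| < #|blocks F|.
Proof.
move=> ne; pose g (X : {set vertex G}) := \bigcup_(x in X) block (e |: F) x.
have gE x : g (block F x) = block (e |: F) x.
  apply/setP => z; apply/bigcupP/idP => [[y]|h]; last by exists x; rewrite // inE linked_refl.
  rewrite !inE => xy; apply: linked_trans; exact: linkedS (subsetUr _ _) xy.
have -> : blocks (e |: F) = g @: blocks F.
  apply/setP => X; apply/imsetP/imsetP => [[x _ ->]|[_ /imsetP[x _ ->] ->]].
    by exists (block F x); rewrite ?imset_f ?gE.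
  by exists x; rewrite // gE.
rewrite ltn_neqAle leq_imset_card andbT; apply: contra ne => /imset_injP inj.
rewrite /joined -block_eq; apply/eqP/inj; rewrite ?imset_f // !gE; apply/eqP.
by rewrite block_eq; apply: joined_mem; rewrite !inE eqxx.
Qed.

Lemma card_blocks_setU R F : (forall e, e \in F -> ~~ joined (R :|: (F :\ e)) e) ->
  #|blocks (R :|: F)| + #|F| <= #|blocks R|.
Proof.
have [n] := ubnP #|F|; elim: n F => // n IHn F lt hF.
case: (set_0Vmem F) => [->|[e eF]]; first by rewrite setU0 cards0 addn0.
have cF := cardsD1 e F; rewrite eF in cF.
have := card_blocks_setU1 (hF e eF).
have -> : e |: (R :|: (F :\ e)) = R :|: F by rewrite setUCA setD1K.
have : #|blocks (R :|: F :\ e)| + #|F :\ e| <= #|blocks R|.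
  apply: IHn; first by lia.
  move=> f; rewrite inE => /andP[_ fF]; apply: contra (hF f fF).
  by apply: linkedS; apply: setUS; apply: setSD; apply: subD1set.
lia.
Qed.

Section Families.
Variable m : nat.
Implicit Types P Q : {ffun 'I_m -> {set edge G}}.

Definition packing P :=
  [forall i, forest (P i)] && [forall i, forall j, (i != j) ==> [disjoint P i & P j]].
Definition uncovered P e := [forall i, e \notin P i].
Definition put P (i : 'I_m) F : {ffun 'I_m -> {set edge G}} :=
  [ffun l => if l == i then F else P l].
Definition exchange : rel {ffun 'I_m -> {set edge G}} := fun P Q =>
  [exists i, exists e, exists f, [&& uncovered P e,
     f \in bridges (P i) (ends e).1 (ends e).2 & Q == put P i (e |: (P i :\ f))]].
Definition total P := \sum_i #|P i|.

Lemma packing_put P i F : packing P -> forest F ->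
  (forall e, e \in F -> uncovered P e || (e \in P i)) -> packing (put P i F).
Proof.
case/andP=> /forallP fP /forallP dP fF hF; apply/andP; split.
  by apply/forallP => l; rewrite ffunE; case: eqP.
have key l : l != i -> [disjoint F & P l].
  move=> li; apply/pred0P => e /=; apply/andP => -[/hF/orP[/forallP/(_ l)/negP//|ei] el].
  have /forallP/(_ i)/implyP/(_ li)/pred0P/(_ e) := dP l.
  by rewrite /= el ei.
apply/forallP => l; apply/forallP => l'; apply/implyP => ll'; rewrite !ffunE.
case: (eqVneq l i) => [li|li]; case: (eqVneq l' i) => [li'|li'].
- by rewrite li li' eqxx in ll'.
- exact: key.
- by rewrite disjoint_sym; apply: key.
- by have /forallP/(_ l')/implyP/(_ ll') := dP l.
Qed.

Lemma total_put P i F : total (put P i F) + #|P i| = total P + #|F|.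
Proof.
rewrite /total (bigD1 i) //= [in RHS](bigD1 i) //= ffunE eqxx.
under eq_bigr => l /negbTE li do rewrite ffunE li.
lia.
Qed.

Lemma maximum_packing_exists : exists P, packing P /\ forall Q, packing Q -> total Q <= total P.
Proof.
have p0 : packing [ffun=> set0].
  apply/andP; split; first by apply/forallP => i; rewrite ffunE; apply/forestP => e; rewrite inE.
  apply/forallP => i; apply/forallP => j; rewrite !ffunE; apply/implyP => _.
  by rewrite -setI_eq0 set0I.
by exists [arg max_(P > [ffun=> set0] | packing P) total P]; case: arg_maxnP.
Qed.

Variable P0 : {ffun 'I_m -> {set edge G}}.
Hypothesis P0_packing : packing P0.
Hypothesis P0_max : forall Q, packing Q -> total Q <= total P0.

Definition reach := [set e | [exists P, connect exchange P0 P && uncovered P e]].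
Let optimal P := packing P && (total P == total P0).

Lemma optimal_joined P e i : optimal P -> uncovered P e -> joined (P i) e.
Proof.
case/andP=> pP /eqP tP ue; apply/negPn/negP => ne.
have fP : forest (P i) by case/andP: pP => /forallP.
have /P0_max : packing (put P i (e |: P i)).
  apply: packing_put => //; first exact: forest_setU1.
  by move=> f; rewrite !inE => /orP[/eqP->|->]; rewrite ?ue ?orbT.
have := total_put P i (e |: P i); rewrite cardsU1 (forallP ue i) tP; lia.
Qed.

Lemma exchange_optimal P Q : optimal P -> exchange P Q -> optimal Q.
Proof.
move=> oP /existsP[i /existsP[e /existsP[f /and3P[ue fb /eqP->]]]].
have [pP /eqP tP] := andP oP; have fP : forest (P i) by case/andP: pP => /forallP.
move: fb; rewrite inE => /andP[fi nf]; rewrite /optimal; apply/andP; split.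
  apply: packing_put => //.
    by apply: forest_setU1 nf; apply: forestS fP; apply: subD1set.
  by move=> g; rewrite !inE => /orP[/eqP->|/andP[_ ->]]; rewrite ?ue ?orbT.
apply/eqP; have := total_put P i (e |: (P i :\ f)).
rewrite cardsU1 !inE (negbTE (forallP ue i)) andbF (cardsD1 f (P i)) fi tP; lia.
Qed.

Lemma connect_optimal P : connect exchange P0 P -> optimal P.
Proof.
have o0 : optimal P0 by rewrite /optimal P0_packing eqxx.
suff key p : forall Q, optimal Q -> path exchange Q p -> optimal (last Q p).
  by case/connectP=> p /(key p P0 o0) h ->.
elim: p => [|Q p IHp] Q0 oQ //= /andP[ex]; apply: IHp.
exact: exchange_optimal oQ ex.
Qed.

Lemma uncovered_reach P e i : connect exchange P0 P -> uncovered P e ->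
  joined (P i :&: reach) e.
Proof.
move=> cP ue; have oP := connect_optimal cP.
have fP : forest (P i) by case/andP: oP => /andP[/forallP].
apply: linkedS (linked_bridges fP (optimal_joined i oP ue)).
apply/subsetP => f fb; have := fb; rewrite inE in_setI => /andP[fi _]; rewrite fi /=.
rewrite inE; apply/existsP; exists (put P i (e |: (P i :\ f))); apply/andP; split.
  apply: connect_trans cP (connect1 _).
  by apply/existsP; exists i; apply/existsP; exists e; apply/existsP; exists f; rewrite ue fb eqxx.
have /andP[/andP[_ /forallP dP] _] := oP.
apply/forallP => l; rewrite ffunE; case: (eqVneq l i) => [_|li].
  rewrite !inE eqxx /= orbF; apply: contraTneq fi => ->; exact: (forallP ue).
have /forallP/(_ i)/implyP/(_ li)/pred0P/(_ f) := dP l.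
by rewrite /= fi andbT => /negbT.
Qed.

Lemma connect_linked_reach P Q i x y : connect exchange P0 P -> connect exchange P Q ->
  linked (Q i :&: reach) x y -> linked (P i :&: reach) x y.
Proof.
move=> cP /connectP[p]; elim: p P cP => [|P1 p IHp] P cP /=; first by move=> _ ->.
case/andP=> ex pp e h; have := IHp _ (connect_trans cP (connect1 ex)) pp e h.
case/existsP: ex => l /existsP[g /existsP[f /and3P[ug _ /eqP->]]].
rewrite ffunE; case: (eqVneq i l) => [->|//].
apply: linked_close => a; rewrite !inE -/reach => /andP[].
case/orP=> [/eqP->|/andP[_ al]] aR; first exact: uncovered_reach.
by apply: joined_mem; rewrite in_setI al inE.
Qed.

Lemma reach_joined e i : e \in reach -> joined (P0 i :&: reach) e.
Proof.
rewrite inE => /existsP[P /andP[cP ue]].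
exact: connect_linked_reach (connect0 _ _) cP (uncovered_reach i cP ue).
Qed.

Lemma linked_reach i x y : linked reach x y -> linked (P0 i) x y.
Proof.
apply: linked_close => e /(reach_joined i); apply: linkedS; exact: subsetIl.
Qed.

Lemma card_blocks_reach i : 0 < #|vertex G| -> #|P0 i :\: reach| < #|blocks reach|.
Proof.
move=> V0; have /andP[/forallP fP _] := P0_packing.
have : #|blocks (reach :|: (P0 i :\: reach))| + #|P0 i :\: reach| <= #|blocks reach|.
  apply: card_blocks_setU => e; rewrite in_setD => /andP[eR ei].
  apply: contra (forestP _ (fP i) e ei); apply: linked_close => f.
  rewrite !in_setU in_setD1 => /orP[/(reach_joined i)|/andP[fe /setDP[fi _]]].
    apply: linkedS; apply/subsetP => g /setIP[gi gR]; rewrite in_setD1 gi andbT.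
    by apply: contraNneq eR => <-.
  by apply: joined_mem; rewrite in_setD1 fe.
have : 0 < #|blocks (reach :|: (P0 i :\: reach))|.
  case/card_gt0P: V0 => x _; apply/card_gt0P.
  by exists (block (reach :|: (P0 i :\: reach)) x); apply: imset_f.
lia.
Qed.

Lemma card_uncovered_reach : #|~: reach| <= \sum_i #|P0 i :\: reach|.
Proof.
have sub : ~: reach \subset \bigcup_i (P0 i :\: reach).
  apply/subsetP => e; rewrite in_setC => eR; apply/bigcupP.
  have : ~~ uncovered P0 e.
    by apply: contra eR => ue; rewrite inE; apply/existsP; exists P0; rewrite connect0.
  by case/forallPn=> i; rewrite negbK => ei; exists i => //; rewrite in_setD eR.
apply: leq_trans (subset_leq_card sub) _.
elim/big_rec2: _ => [|i n A _ le]; first by rewrite cards0.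
by apply: leq_trans (leq_card_setU _ _) _; rewrite leq_add2l.
Qed.
End Families.

Lemma edge_connected_packing m : edge_connected m.*2 G ->
  exists F : 'I_m -> {set edge G}, edge_disjoint F /\ forall i, connected_factor (F i).
Proof.
move=> ec; have [P [pP maxP]] := maximum_packing_exists m.
have [_ /forallP dP] := andP pP.
exists P; split; first by move=> i j ij; have /forallP/(_ j)/implyP/(_ ij) := dP i.
move=> i x y; apply: (linked_reach pP maxP); set R := reach P.
apply/negPn/negP => nxy.
have V0 : 0 < #|vertex G| by apply/card_gt0P; exists x.
have cut X : X \in blocks R -> m.*2 <= #|edge_cut X|.
  case/imsetP=> z _ ->; apply: ec; first by apply/set0Pn; exists z; rewrite inE linked_refl.
  apply: contra nxy => /eqP bz; have inb w : linked R z w by have := in_setT w; rewrite -bz inE.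
  by apply: linked_trans (inb y); rewrite linked_sym.
have sum_cut : \sum_(X in blocks R) #|edge_cut X| <= (#|~: R|).*2.
  have -> : \sum_(X in blocks R) #|edge_cut X|
      = \sum_e \sum_(X in blocks R) (e \in edge_cut X).
    rewrite exchange_big /=; apply: eq_bigr => X _.
    by rewrite -sum1_card big_mkcond /=; apply: eq_bigr => e _; case: (e \in _).
  rewrite -muln2 -sum_nat_const [leqRHS]big_mkcond /=; apply: leq_sum => e _.
  rewrite in_setC; case: (boolP (e \in R)) => [/joined_mem je|_] /=.
    rewrite big1 // => X /imsetP[z _ ->]; rewrite !inE.
    have -> : linked R z (ends e).1 = linked R z (ends e).2.
      apply/idP/idP => h; first exact: linked_trans je.
      by apply: linked_trans h _; rewrite linked_sym.
    by rewrite addbb.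
  have split_cut X : X \in blocks R -> (e \in edge_cut X) <=
      (X == block R (ends e).1) + (X == block R (ends e).2).
    case/imsetP=> z _ ->; rewrite !block_eq !inE.
    by case: (linked R z _); case: (linked R z _).
  apply: (@leq_trans (\sum_(X in blocks R)
    ((X == block R (ends e).1) + (X == block R (ends e).2)))).
    exact: leq_sum.
  have one a : \sum_(X in blocks R) (X == block R a) = 1.
    rewrite (bigD1 (block R a)) ?imset_f //= eqxx big1 // => X /andP[_ /negbTE->//].
  by rewrite big_split /= !one.
have le1 : #|blocks R| * m.*2 <= \sum_(X in blocks R) #|edge_cut X|.
  by rewrite -sum_nat_const; apply: leq_sum.
have le2 : \sum_l #|P l :\: R| <= m * (#|blocks R|).-1.
  rewrite -[m in m * _]card_ord -sum_nat_const; apply: leq_sum => l _.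
  have := card_blocks_reach pP maxP l V0; rewrite -/R; lia.
have le3 := card_uncovered_reach P; rewrite -/R in le3.
have m0 : 0 < m by case: m i {ec P pP maxP dP R nxy cut sum_cut le1 le2 le3} => // -[].
have b0 : 0 < #|blocks R| by apply/card_gt0P; exists (block R x); apply: imset_f.
nia.
Qed.
End Packing.

(** * Colourings with prescribed parities *)

Section Joins.
Variable G : multigraph.
Implicit Types (F J K : {set edge G}) (x y v : vertex G).

Lemma connected_crosses F (X : {set vertex G}) : connected_factor F ->
  X != set0 -> X != setT -> exists e, e \in F :&: edge_cut X.
Proof.
move=> cF /set0Pn[x xX] nT.
have [y yX] : exists y, y \notin X.
  apply/existsP; apply: contraNT nT => /existsPn h; apply/eqP/setP => y.
  by rewrite inE; have := h y; rewrite negbK.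
apply/set0Pn/negP => /eqP no.
have cl : closed (adjacent_in F) X.
  move=> u w /adjacentP[e eF uw]; have := in_set0 e; rewrite -no !inE eF /=.
  by case: uw => -> /= /negbT; rewrite addbC; do 2!case: (_ \in X).
by have := closed_connect cl (cF x y); rewrite xX (negbTE yX).
Qed.

Lemma tree_connected_edge_connected m : tree_connected m G -> edge_connected m G.
Proof.
case=> T [sT dT] X X0 XT.
have [f fP] : exists f : 'I_m -> edge G, forall i, f i \in T i :&: edge_cut X.
  apply: (fin_all_exists (P := fun i e => e \in T i :&: edge_cut X)) => i.
  by apply: connected_crosses => //; case: (sT i).
have f_inj : injective f.
  move=> i j fij; apply/eqP; apply: contraT => ij.
  have /pred0P/(_ (f i)) := dT i j ij; have := fP i; have := fP j.
  by rewrite -fij !in_setI /= => /andP[-> _] /andP[-> _].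
rewrite -[m]card_ord -(card_imset _ f_inj); apply/subset_leq_card/subsetP.
by move=> _ /imsetP[i _ ->]; have := fP i; rewrite inE => /andP[].
Qed.

Lemma odd_degree_symdiff J K v :
  odd (degree_in ((J :\: K) :|: (K :\: J)) v) = odd (degree_in J v) (+) odd (degree_in K v).
Proof.
rewrite /degree_in (big_setID J) /= [in RHS](big_setID K) /=.
rewrite [X in _ (+) odd X](big_setID J) /= [K :&: J]setIC.
have -> : ((J :\: K) :|: (K :\: J)) :&: J = J :\: K.
  by apply/setP => e; rewrite !inE; case: (e \in J); case: (e \in K).
have -> : ((J :\: K) :|: (K :\: J)) :\: J = K :\: J.
  by apply/setP => e; rewrite !inE; case: (e \in J); case: (e \in K).
by rewrite !oddD [X in _ = X (+) _]addbC addbA -[X in _ = X (+) _]addbA addbb addbF.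
Qed.

Lemma symdiff_sub F J K : J \subset F -> K \subset F -> (J :\: K) :|: (K :\: J) \subset F.
Proof.
by move=> JF KF; rewrite subUset (subset_trans _ JF) ?(subset_trans _ KF) ?subsetDl.
Qed.

Lemma linked_join F x y : linked F x y ->
  exists2 J : {set edge G}, J \subset F & forall v, odd (degree_in J v) = (v == x) (+) (v == y).
Proof.
case/connectP=> p; elim: p x => [|z p IHp] x /=.
  by move=> _ ->; exists set0; rewrite ?sub0set // => v; rewrite /degree_in big_set0 addbb.
case/andP=> /adjacentP[e eF xz] /IHp{}IHp /IHp[J JF JP].
exists ((J :\: [set e]) :|: ([set e] :\: J)).
  by apply: symdiff_sub; rewrite ?sub1set.
move=> v; rewrite odd_degree_symdiff JP /degree_in big_set1 oddD !oddb.
by case: xz => -> /=; rewrite ![_ == v]eq_sym; do 3!case: (v == _).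
Qed.

Lemma parity_join F (T : {set vertex G}) : connected_factor F -> ~~ odd #|T| ->
  exists2 J : {set edge G}, J \subset F & forall v, odd (degree_in J v) = (v \in T).
Proof.
move=> cF; have [n] := ubnP #|T|; elim: n T => // n IHn T lt evT.
case: (set_0Vmem T) => [->|[x xT]].
  by exists set0; rewrite ?sub0set // => v; rewrite /degree_in big_set0 inE.
have cT := cardsD1 x T; rewrite xT in cT.
have [y yT] : exists y, y \in T :\ x by apply/card_gt0P; lia.
have cTx := cardsD1 y (T :\ x); rewrite yT in cTx.
have [||J JF JP] := IHn (T :\ x :\ y); [lia | lia |].
have [K KF KP] := linked_join (cF x y).
exists ((J :\: K) :|: (K :\: J)).
  exact: symdiff_sub.
move=> v; rewrite odd_degree_symdiff JP KP; move: yT; rewrite !inE => /andP[yx yT].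
case: (eqVneq v x) => [->|_] /=; first by rewrite xT andbF eq_sym (negbTE yx).
by case: (eqVneq v y) => [->|_] /=; rewrite ?yT ?addbF.
Qed.

Lemma odd_sum (I : finType) (P : pred I) (f : I -> nat) :
  odd (\sum_(i | P i) f i) = \big[addb/false]_(i | P i) odd (f i).
Proof. by apply: (big_morph odd oddD). Qed.

Lemma parity_colouring k (O : vertex G -> 'I_k -> bool) : 0 < k -> edge_connected (2 * k - 2) G ->
  (forall j, ~~ odd #|[set v | O v j]|) ->
  (forall v, odd (\sum_j O v j) = odd (degree v)) ->
  exists c : {ffun edge G -> 'I_k}, forall v j, odd (col_degree c j v) = O v j.
Proof.
case: k O => // m O _ ec evO sumO.
have [|F [dF cF]] := @edge_connected_packing G m.
  by rewrite -muln2; congr (edge_connected _ G): ec; lia.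
have [J JP] : exists J : 'I_m -> {set edge G}, forall i, (J i \subset F i) /\
    forall v, odd (degree_in (J i) v) = O v (lift ord_max i).
  apply: (fin_all_exists (P := fun i K => K \subset F i /\
    forall v, odd (degree_in K v) = O v (lift ord_max i))) => i.
  have [K KF KP] := parity_join (cF i) (evO (lift ord_max i)).
  by exists K; split=> // v; rewrite KP inE.
pose c := [ffun e => if [pick i | e \in J i] is Some i then lift ord_max i else ord_max].
have cJ i : col_class c (lift ord_max i) = J i.
  apply/setP => e; rewrite inE ffunE; case: pickP => [l el|no]; last first.
    by rewrite no (negbTE (neq_lift _ _)).
  rewrite (inj_eq lift_inj); apply/eqP/idP => [<- //|ei].
  apply/eqP; apply: contraT => li; have /pred0P/(_ e) := dF l i li.
  by rewrite /= (subsetP (JP l).1) // (subsetP (JP i).1).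
exists c.
have lifted v i : odd (col_degree c (lift ord_max i) v) = O v (lift ord_max i).
  by rewrite /col_degree cJ (JP i).2.
move=> v j; case: (unliftP ord_max j) => [i ->|->]; first exact: lifted.
have e := sumO v; rewrite -(sum_col_degree c) !odd_sum in e.
apply: (@addIb (\big[addb/false]_(i | i != ord_max) odd (col_degree c i v))).
move: e; rewrite (bigD1 ord_max) //= [in RHS](bigD1 ord_max) //= oddb => <-.
congr addb; apply: eq_bigr.
move=> l; case: (unliftP ord_max l) => [i -> _|->]; last by rewrite eqxx.
by rewrite oddb lifted.
Qed.
End Joins.

Section Pattern.
Variable k : nat.
Hypothesis k0 : 0 < k.

(* Walking [p] steps around a cycle of length [k] uses its [j]-th edge
   [crossings j p] times. *)
Definition crossings (j p : nat) := \sum_(t < p) (t %% k == j).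

Lemma crossingsS j p : crossings j p.+1 = crossings j p + (p %% k == j).
Proof. by rewrite /crossings big_ord_recr. Qed.

Lemma crossings_turn (j : 'I_k) p : crossings j (p + k) = (crossings j p).+1.
Proof.
elim: p => [|p IHp]; last by rewrite addSn !crossingsS IHp modnDr addSn.
rewrite add0n /crossings big_ord0 (bigD1 j) //= modn_small // eqxx big1 // => t.
by rewrite modn_small // -val_eqE /= => /negbTE->.
Qed.

Lemma crossings_turns (j : 'I_k) p n : crossings j (p + n * k) = crossings j p + n.
Proof.
elim: n => [|n IHn]; first by rewrite mul0n !addn0.
by rewrite mulSn addnCA addnC crossings_turn IHn addnS.
Qed.

Lemma sum_crossings p : \sum_(j < k) crossings j p = p.
Proof.
elim: p => [|p IHp]; first by rewrite big1 // => j _; rewrite /crossings big_ord0.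
under eq_bigr => j _ do rewrite crossingsS.
rewrite big_split /= IHp -addn1; congr (_ + _).
have pk : p %% k < k by rewrite ltn_mod.
rewrite (bigD1 (Ordinal pk)) //= eqxx big1 // => j.
by rewrite -val_eqE eq_sym => /negbTE /= ->.
Qed.

Lemma leq_crossings j p q : crossings j p <= crossings j (p + q).
Proof. by elim: q => [|q IHq]; rewrite ?addn0 // addnS crossingsS (leq_trans IHq) ?leq_addr. Qed.

Definition odd_residue d := if odd (d %/ k) then k - d %% k else d %% k.

Lemma odd_odd_residue d : odd (odd_residue d) = odd d.
Proof.
rewrite /odd_residue [in RHS](divn_eq d k) oddD oddM.
case: (odd (d %/ k)) => //=; rewrite oddB //; exact/ltnW/ltn_pmod.
Qed.

Lemma sum_odd_crossings p d :
  \sum_(j < k) (odd (crossings j (p + d)) (+) odd (crossings j p)) = odd_residue d.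
Proof.
have rk := ltn_pmod d k0; set r := d %% k in rk.
pose z (j : 'I_k) := crossings j (p + r) - crossings j p.
have zP (j : 'I_k) : crossings j (p + r) = crossings j p + z j /\ z j <= 1.
  have := leq_crossings j p r; have := leq_crossings j (p + r) (k - r).
  have -> : p + r + (k - r) = p + k by lia.
  rewrite crossings_turn /z; lia.
have sumz : \sum_j z j = r.
  have : \sum_(j < k) crossings j (p + r) = \sum_(j < k) crossings j p + \sum_j z j.
    by rewrite -big_split /=; apply: eq_bigr => j _; case: (zP j).
  rewrite !sum_crossings; lia.
have -> : \sum_(j < k) (odd (crossings j (p + d)) (+) odd (crossings j p))
    = \sum_j (odd (z j) (+) odd (d %/ k)).
  apply: eq_bigr => j _; have -> : p + d = p + r + d %/ k * k by rewrite /r {1}(divn_eq d k); lia.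
  rewrite crossings_turns oddD (zP j).1 oddD.
  by case: (odd (z j)); case: (odd (crossings _ _)); case: (odd (_ %/ _)).
have z1 j : z j = odd (z j) by have := (zP j).2; case: (z j) => [|[]].
rewrite /odd_residue -/r; case: (odd (d %/ k)); last first.
  by rewrite -sumz; apply: eq_bigr => j _; rewrite addbF -z1.
have : \sum_j (odd (z j) (+) true) + \sum_j z j = k.
  rewrite -big_split /= -[RHS]card_ord -sum1_card; apply: eq_bigr => j _.
  by rewrite [in X in _ + X]z1; case: (odd (z j)).
by rewrite sumz => e; rewrite -[X in _ = X - _]e addnK.
Qed.

Lemma odd_pattern (V : finType) (d : V -> nat) (Z : {set V}) :
  2 * \sum_(v in Z) d v = \sum_v d v %[mod 2 * k] ->
  exists O : V -> 'I_k -> bool, (forall v, \sum_j O v j = odd_residue (d v)) /\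
    forall j, ~~ odd #|[set v | O v j]|.
Proof.
pose step v := if v \in Z then (2 * k).-1 * d v else d v.
have walk (s : seq V) p : uniq s -> exists O : V -> 'I_k -> bool,
    (forall v, v \in s -> \sum_j O v j = odd_residue (d v)) /\
    forall j, odd (\sum_(v <- s) O v j) =
      odd (crossings j p) (+) odd (crossings j (p + \sum_(v <- s) step v)).
  elim: s p => [|v s IHs] p /=.
    by move=> _; exists (fun _ _ => false); split=> // j; rewrite !big_nil addn0 addbb.
  case/andP=> vs /(IHs (p + step v))[O [sumO oddO]].
  pose Ov (j : 'I_k) := odd (crossings j p) (+) odd (crossings j (p + step v)).
  exists (fun w => if w == v then Ov else O w); split=> [w|j].
    rewrite inE; case: (eqVneq w v) => [-> _|wv /= ws]; last exact: sumO.
    rewrite /Ov /step; case: (v \in Z); last first.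
      by rewrite -(sum_odd_crossings p); apply: eq_bigr => j _; rewrite addbC.
    rewrite -(sum_odd_crossings (p + (2 * k).-1 * d v)); apply: eq_bigr => j _.
    have -> : p + (2 * k).-1 * d v + d v = p + (2 * d v) * k by nia.
    by rewrite crossings_turns oddD oddM addbF.
  rewrite !big_cons eqxx oddD oddb addnA.
  have -> : \sum_(w <- s) (if w == v then Ov else O w) j = \sum_(w <- s) O w j.
    rewrite big_seq [RHS]big_seq; apply: eq_bigr => w ws; case: eqP => // e.
    by rewrite e (negbTE vs) in ws.
  by rewrite oddO /Ov addbA -[X in X (+) _ = _]addbA addbb addbF.
move=> eqm; have [O [sumO oddO]] := walk (index_enum V) 0 (index_enum_uniq V).
exists O; split=> [v|j]; first exact/sumO/mem_index_enum.
have -> : #|[set v | O v j]| = \sum_v O v j.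
  by rewrite -sum1_card big_mkcond; apply: eq_bigr => v _; rewrite inE; case: (O v j).
have dvd : 2 * k %| \sum_v step v.
  have -> : \sum_v step v = \sum_v d v + (2 * k - 2) * \sum_(v in Z) d v.
    rewrite big_distrr /= [in RHS](big_mkcond (fun v => v \in Z)) -big_split /=.
    by apply: eq_bigr => v _; rewrite /step; case: (v \in Z); nia.
  rewrite /dvdn -modnDml -eqm modnDml -mulnDl.
  by rewrite (_ : 2 + (2 * k - 2) = 2 * k) ?modnMr //; lia.
case/dvdnP: dvd => n en.
rewrite oddO add0n en (_ : n * (2 * k) = 0 + (2 * n) * k); last by lia.
by rewrite crossings_turns /crossings big_ord0 /= add0n oddM.
Qed.
End Pattern.

Lemma near_equal_mean (k : nat) (y : 'I_k -> nat) : (0 < k)%N ->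
  (forall i j, y i <= y j + 1)%N ->
  forall i, (`| (y i)%:R - (\sum_j y j)%N%:R / k%:R | < 1 :> rat)%R.
Proof.
move=> k0 y1 i.
have sumD1 : (\sum_j y j + k = \sum_j (y j + 1))%N.
  by rewrite big_split /= sum_nat_const card_ord muln1.
have hi : (y i * k < \sum_j y j + k)%N.
  have -> : (y i * k = \sum_(j < k) y i)%N by rewrite sum_nat_const card_ord mulnC.
  rewrite sumD1 (bigD1 i) // [ltnRHS](bigD1 i) //=.
  by rewrite addn1 addSn ltnS leq_add2l; apply: leq_sum => j _; have := y1 i j; have := y1 j i; lia.
have lo : (\sum_j y j < (y i + 1) * k)%N.
  have -> : ((y i + 1) * k = \sum_(j < k) (y i + 1))%N.
    by rewrite sum_nat_const card_ord mulnC.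
  rewrite (bigD1 i) // [ltnRHS](bigD1 i) //=.
  by rewrite addn1 addSn ltnS leq_add2l; apply: leq_sum => j _; have := y1 i j; have := y1 j i; lia.
have kR : (0 < k%:R :> rat)%R by rewrite ltr0n.
rewrite ltr_distl ltrBlDr ltr_pdivrMr // natr1 -natrM ltr_nat.
apply/andP; split; first by rewrite -[(y i).+1]addn1.
rewrite -[X in (_ + X)%R](divff (lt0r_neq0 kR)) -mulrDl ltr_pdivlMr //.
by rewrite -natrD -natrM ltr_nat.
Qed.

Unset Implicit Arguments.
Local Open Scope ring_scope.

Theorem theorem3p3 (G : multigraph) (k : nat) (hk : (0 < k)%N)
  (hG : edge_connected (3 * k - 3) G \/ tree_connected (2 * k - 2) G \/
        [/\ loopless G, edge_connected (2 * k - 1) G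
          & essentially_edge_connected (3 * k - 3) G])
  (hZ : exists Z : {set vertex G},
      (#|edge G| = \sum_(v in Z) degree v %[mod k])%N) :
  exists F : 'I_k -> {set edge G},
    [/\ edge_decomposition F,
        forall i : 'I_k,
          `| #|F i|%:R - #|edge G|%:R / k%:R | < 1 :> rat
      & forall (i : 'I_k) (v : vertex G),
          `| (degree_in (F i) v)%:R - (degree v)%:R / k%:R | < 1 :> rat].
Proof.
have ec : edge_connected (2 * k - 2) G.
  case: hG => [h|[/tree_connected_edge_connected//|[_ h _]]] X X0 XT;
    have := h X X0 XT; lia.
have [Z hZ'] := hZ.
have handshake : (\sum_(v : vertex G) degree v = #|edge G|.*2)%N by rewrite -cardsT -sum_degree_in.
have [|O [sumO evO]] := @odd_pattern k hk _ (@degree G) Z.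
  by rewrite handshake -mul2n -!muln_modr hZ'.
have [|c cO] := parity_colouring hk ec evO.
  by move=> v; rewrite sumO odd_odd_residue.
have [c1 [odd1 near1]] := near_equal_colouring c.
have eq1 : equitable c1.
  move=> v; apply: near_equal_parity_equitable (near1 v) _.
  rewrite (sum_col_degree c1) -/(odd_residue k (degree v)) -sumO.
  by rewrite -/(odd_colours c1 v) odd1; apply: eq_bigr => j _; rewrite cO.
have [c2 eq2 size2] := equitable_sizes eq1.
exists (col_class c2); split.
- split=> [i j ij|].
    by apply/pred0P => e /=; rewrite !inE; case: eqP => // ->; apply/negbTE.
  by apply/setP => e; rewrite inE; apply/bigcupP; exists (c2 e); rewrite ?inE.
- by move=> i; rewrite -(sum_col_class c2); apply: (near_equal_mean hk size2).
- by move=> i v; rewrite -(sum_col_degree c2); apply: (near_equal_mean hk (eq2 v)).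
Qed.
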